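(* Let $G$ be a countable group. Then $\operatorname{asdim} G = 0$ if and only if every finitely generated subgroup of $G$ is finite.
   Context: Asymptotic dimension of a metric space: a family $\mathcal{U}$ of subsets of a metric space $(X,d)$ is $R$-bounded if $\sup\{\operatorname{diam} U \mid U\in\mathcal{U}\}\le R$, and it is $D$-disjoint if $d(x,y)>D$ whenever $x\in U$, $y\in V$, $U,V\in\mathcal{U}$ and $U\ne V$. One says $\operatorname{asdim} X\le n$ if for every $D>0$ there are a number $R$ and $n+1$ families $\mathcal{U}_0,\dots,\mathcal{U}_n$ of subsets of $X$, each $D$-disjoint and $R$-bounded, such that $\bigcup_i\mathcal{U}_i$ is a cover of $X$; $\operatorname{asdim} X$ is the least such $n$. Asymptotic dimension of a countable group: a metric is proper if closed bounded sets are compact. Every countable group $G$ admits a left invariant proper metric (for such a metric every bounded set is finite), any two such metrics are coarsely equivalent, and asymptotic dimension is invariant under coarse equivalence. $\operatorname{asdim} G$ denotes the asymptotic dimension of $(G,d)$ for any left invariant proper metric $d$ on $G$; it does not depend on the choice of $d$. *)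

(* Defs.v *)
From HB Require Import structures.
From mathcomp Require Import all_boot all_order all_algebra.
From mathcomp Require Import ring lra.
From mathcomp Require Import all_classical all_reals.
From mathcomp Require Import ereal topology.

Set Implicit Arguments.
Unset Strict Implicit.
Unset Printing Implicit Defensive.

Import Order.TTheory GRing.Theory Num.Theory.

Local Open Scope classical_set_scope.
Local Open Scope ring_scope.

Section asymptotic_dimension.
Variables (R : realType) (X : metricType R).
Implicit Types (U V : set X) (F : set (set X)).

(* The supremum is taken in [\bar R]: [+oo] for unbounded sets, and [-oo] for
   the empty set, which satisfies every bound. *)
Definition diam U : \bar R :=
  ereal_sup [set (mdist x y)%:E | x in U & y in U].

Definition family_bounded (B : R) F : Prop :=
  (ereal_sup [set diam U | U in F] <= B%:E)%E.

Definition family_disjoint (D : R) F : Prop :=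
  forall U V x y, F U -> F V -> U x -> V y -> U <> V -> D < mdist x y.

Definition asdim_le (n : nat) : Prop :=
  forall D : R, 0 < D ->
  exists (B : R) (F : 'I_n.+1 -> set (set X)),
    (forall i, family_disjoint D (F i) /\ family_bounded B (F i)) /\
    \bigcup_(i in [set: 'I_n.+1]) \bigcup_(U in F i) U = [set: X].

(* [+oo] when no [n] satisfies [asdim_le n]. *)
Definition asdim : \bar nat :=
  if pselect (exists n, `[< asdim_le n >]) is left h then EFin (ex_minn h)
  else +oo%E.

Definition metric_bounded (A : set X) : Prop :=
  exists M : R, forall x y, A x -> A y -> mdist x y <= M.

Definition proper_metric : Prop :=
  forall A : set X, closed A -> metric_bounded A -> compact A.

End asymptotic_dimension.
Arguments asdim {R} X.
Arguments proper_metric {R} X.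

(* A metric as a term, so that one can range over all metrics on a fixed [T]. *)
Record metric_on (R : realType) (T : choiceType) := MetricOn {
  metric_dist :> T -> T -> R ;
  metric_distxx : forall x, metric_dist x x = 0 ;
  metric_dist_pos : forall x y, metric_dist x y = 0 -> x = y ;
  metric_dist_sym : forall x y, metric_dist x y = metric_dist y x ;
  metric_dist_triangle : forall y x z,
    metric_dist x z <= metric_dist x y + metric_dist y z
}.

(* The metric space [(T, d)]: an alias of [T] carrying the topology and
   uniform structure of [d]. *)
Definition metric_space (R : realType) (T : choiceType) (d : metric_on R T)
  : Type := T.

HB.instance Definition _ (R : realType) (T : choiceType) (d : metric_on R T) :=
  Choice.on (metric_space d).
HB.instance Definition _ (R : realType) (T : choiceType) (d : metric_on R T) :=
  isMetric.Build R (metric_space d) (metric_distxx d) (@metric_dist_pos _ _ d)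
    (metric_dist_sym d) (metric_dist_triangle d).

Section group_asymptotic_dimension.
Variables (R : realType) (G : groupType).
Implicit Type d : metric_on R G.

Definition left_invariant d : Prop :=
  forall g x y : G, d (g * x)%g (g * y)%g = d x y.

Definition proper_left_invariant d : Prop :=
  left_invariant d /\ proper_metric (metric_space d).

(* The asymptotic dimension of [(G, d)] for a chosen [d]; [group_asdimE] shows
   that for countable [G] it is that of [(G, d)] for every [d], and
   [proper_left_invariant_exists] that such a [d] exists. *)
Definition group_asdim : \bar nat :=
  xget +oo%E [set asdim (metric_space d) | d in proper_left_invariant].

End group_asymptotic_dimension.
Arguments group_asdim R G : clear implicits.

Section subgroups.
Variable G : groupType.

Definition subgroup (H : set G) : Prop := group_closed [in H].

Definition finitely_generated (H : set G) : Prop :=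
  exists2 S : set G, finite_set S & H = smallest subgroup S.

End subgroups.

Section proper_left_invariant_exists.
Variables (R : realType) (G : groupType) (f : G -> nat).
Hypothesis finj : injective f.
Local Open Scope group_scope.

Let F := fix F (n : nat) : set G := if n is m.+1 then
  [set x * y | x in F m & y in F m] `|` (f @^-1` [set m] `|`
   (fun g => f g^-1) @^-1` [set m]) else [set 1].

Let F1 n : F n 1.
Proof. by elim: n => //= n IH; left; exists 1 => //; exists 1 => //; rewrite mul1g. Qed.

Let FS n : F n `<=` F n.+1.
Proof. by move=> x Fx; left; exists x => //; exists 1 => //; rewrite mulg1. Qed.

Let Fle m n : (m <= n)%N -> F m `<=` F n.
Proof.
move=> /subnK <-; elim: (n - m)%N => // k IH x /IH Fx.
by rewrite addSn; exact: FS.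
Qed.

Let FV n x : F n x -> F n x^-1.
Proof.
elim: n x => [x ->|n IH x] /=; first by rewrite invg1.
case=> [[y Fy [z Fz <-]]|[|] /= e].
- by left; exists z^-1; [exact: IH|exists y^-1; [exact: IH|rewrite invgM]].
- by right; right => /=; rewrite invgK.
- by right; left.
Qed.

Let Ffin n : finite_set (F n).
Proof.
elim: n => [|n IH] /=; first exact: finite_set1.
rewrite !finite_setU; split; first exact: finite_image2.
split.
  apply: finite_preimage; last exact: finite_set1.
  by move=> x y _ _ /finj.
apply: finite_preimage; last exact: finite_set1.
by move=> x y _ _ /finj /invg_inj.
Qed.

Let Fex x : exists n, `[< F n x >].
Proof. by exists (f x).+1; apply/asboolP; right; left. Qed.

Let N x := ex_minn (Fex x).

Let NF x : F (N x) x.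
Proof. by rewrite /N; case: ex_minnP => n /asboolP. Qed.

Let Nmin n x : F n x -> (N x <= n)%N.
Proof. by rewrite /N; case: ex_minnP => m _ h Fx; apply: h; apply/asboolP. Qed.

Let N0 x : N x = 0%N -> x = 1.
Proof. by move=> h; have := NF x; rewrite h. Qed.

Let N1 : N 1 = 0%N.
Proof. by apply/eqP; rewrite -leqn0; apply: Nmin. Qed.

Let NV x : N x^-1 = N x.
Proof.
apply/eqP; rewrite eqn_leq; apply/andP; split; apply: Nmin.
  exact/FV/NF.
by rewrite -[X in F _ X]invgK; exact/FV/NF.
Qed.

Let NM x y : (N (x * y) <= N x + N y)%N.
Proof.
have [/N0 ->|x0] := eqVneq (N x) 0%N; first by rewrite mul1g leq_addl.
have [/N0 ->|y0] := eqVneq (N y) 0%N; first by rewrite mulg1 leq_addr.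
apply: (@leq_trans (maxn (N x) (N y)).+1).
  apply: Nmin; left; exists x; first exact: (Fle (leq_maxl _ _)).
  by exists y => //; exact: (Fle (leq_maxr _ _)).
rewrite gtn_max -{1}[N x]addn0 -{2}[N y]add0n ltn_add2l ltn_add2r.
by rewrite !lt0n x0 y0.
Qed.

Let dist (x y : G) : R := (N (x^-1 * y))%:R%R.

Let dist_xx x : dist x x = 0%R.
Proof. by rewrite /dist mulVg N1. Qed.

Let dist_pos x y : dist x y = 0%R -> x = y.
Proof.
move=> /eqP; rewrite pnatr_eq0 => /eqP/N0 h.
by apply: (mulgI x^-1); rewrite mulVg h.
Qed.

Let dist_sym x y : dist x y = dist y x.
Proof. by rewrite /dist -NV invgM invgK. Qed.

Let dist_triangle y x z : (dist x z <= dist x y + dist y z)%R.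
Proof.
rewrite /dist -natrD ler_nat.
have -> : x^-1 * z = (x^-1 * y) * (y^-1 * z) by rewrite mulgA mulgK.
exact: NM.
Qed.

Lemma proper_left_invariant_of_inj :
  exists d : metric_on R G, proper_left_invariant d.
Proof.
exists (MetricOn dist_xx dist_pos dist_sym dist_triangle); split.
  by move=> g x y; rewrite /= /dist invgM -mulgA mulKg.
move=> A _ [M AM]; have [->|/set0P[x Ax]] := eqVneq A set0.
  exact: compact0.
apply: finite_compact.
pose m := Num.truncn M.
apply: (@sub_finite_set _ _ [set x * z | z in F m]); last first.
  exact/finite_image/Ffin.
move=> y Ay; exists (x^-1 * y); last by rewrite mulVKg.
apply: (Fle _ (NF _)); rewrite /m.
have := AM _ _ Ax Ay; rewrite /mdist /= /dist => h.
by rewrite truncn_ge_nat // (le_trans _ h).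
Qed.

End proper_left_invariant_exists.

Lemma proper_left_invariant_exists (R : realType) (G : groupType) :
  countable [set: G] -> exists d : metric_on R G, proper_left_invariant d.
Proof.
move=> /countable_injP[f finj]; apply: (@proper_left_invariant_of_inj R G f).
by move=> x y; apply: finj; rewrite inE.
Qed.

Section proper_left_invariant_unique.
Variables (R : realType) (G : groupType).
Hypothesis Gcount : countable [set: G].
Implicit Type d : metric_on R G.

Lemma metric_on_ge0 d x y : 0 <= d x y.
Proof. exact: (@mdist_ge0 R (metric_space d)). Qed.

Lemma metric_bounded_closed_ball d (x : G) (r : R) :
  metric_bounded ([set y | d x y <= r] : set (metric_space d)).
Proof.
exists (r + r) => y z /= xy xz; rewrite /mdist /=.
by apply: le_trans (metric_dist_triangle d x y z) _; rewrite metric_dist_sym lerD.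
Qed.

Lemma closed_closed_ball d (x : G) (r : R) :
  closed ([set y | d x y <= r] : set (metric_space d)).
Proof.
move=> p clp; rewrite /= leNgt; apply/negP => rp.
have e0 : 0 < d x p - r by rewrite subr_gt0.
have [y [/= xy]] := clp _ (nbhsx_ballx (p : metric_space d) _ e0).
rewrite ballEmdist /= /mdist /= => py.
have := metric_dist_triangle d y x p; rewrite (metric_dist_sym d y p).
lra.
Qed.

(* A Baire argument: otherwise nested closed balls avoid every element. *)
Lemma proper_left_invariant_discrete d : proper_left_invariant d ->
  exists2 e : R, 0 < e & forall x y, d x y < e -> x = y.
Proof.
move=> [dl dp]; apply: contrapT => nd.
have acc (x : G) (e : R) : 0 < e -> exists2 y, x <> y & d x y < e.
  move=> e0; apply: contrapT => h; apply: nd; exists e => // u v uv.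
  apply: contrapT => neq; apply: h; exists (x * (u^-1 * v))%g.
    move=> /(congr1 (fun z => x^-1 * z)%g); rewrite mulVg mulKg => h.
    by apply: neq; apply: (mulgI u^-1%g); rewrite mulVg h.
  by rewrite -[X in d X _]mulg1 dl -[X in d X _](mulVg u) dl.
have /countable_injP[f finj'] := Gcount.
have finj : injective f by move=> x y; apply: finj'; rewrite inE.
pose C (p : G * R) : set G := [set y | d p.1 y <= p.2].
have step (n : nat) (p : G * R) : exists q : G * R, 0 < p.2 ->
    [/\ 0 < q.2, C q `<=` C p & forall z, f z = n -> ~ C q z].
  case: p => x r; have [r0|nr0] := pselect (0 < r); last by exists (x, r).
  have sub (x' : G) (r' : R) : d x x' + r' <= r -> C (x', r') `<=` C (x, r).
    move=> h y; rewrite /C /= => xy.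
    have := metric_dist_triangle d x' x y; lra.
  have [[z fz]|nz] := pselect (exists z, f z = n); last first.
    by exists (x, r) => _; split => // z fz; case: nz; exists z.
  have [xz|/eqP xz] := eqVneq x z.
    have r2 : 0 < r / 2 by lra.
    have [x' neq dx'] := acc x _ r2.
    have d0 : 0 < d x x'.
      rewrite lt_def metric_on_ge0 andbT; apply/eqP => /metric_dist_pos.
      exact: neq.
    exists (x', Num.min (r / 2) (d x x' / 2)) => _; split => /=.
    - by rewrite lt_min; apply/andP; split; lra.
    - apply: sub; have : Num.min (r / 2) (d x x' / 2) <= r / 2.
        by rewrite ge_min lexx.
      lra.
    - move=> w fw; have -> : w = x by rewrite xz; apply: finj; rewrite fw fz.
      rewrite /C /= metric_dist_sym le_min => /andP[_]; lra.
  have d0 : 0 < d x z.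
    rewrite lt_def metric_on_ge0 andbT; apply/eqP => /metric_dist_pos.
    exact: xz.
  exists (x, Num.min r (d x z / 2)) => _; split => /=.
  - by rewrite lt_min; apply/andP; split; lra.
  - by apply: sub; rewrite metric_distxx add0r ge_min lexx.
  - move=> w fw; have -> : w = z by apply: finj; rewrite fw fz.
    rewrite /C /= le_min => /andP[_]; lra.
have [g gP] := choice (fun np : nat * (G * R) => step np.1 np.2).
pose p := fix p n : G * R := if n is m.+1 then g (m, p m) else (1%g, 1).
have p0 n : 0 < (p n).2.
  elim: n => [|n IH] /=; first exact: ltr01.
  by have [] := gP (n, p n) IH.
have Csub m n : (m <= n)%N -> C (p n) `<=` C (p m).
  move=> /subnK <-; elim: (n - m)%N => // k IH; rewrite addSn /=.
  by apply: subset_trans IH; have [] := gP ((k + m)%N, p (k + m)%N) (p0 _).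
have Cc n : compact (C (p n) : set (metric_space d)).
  by apply: dp; [exact: closed_closed_ball|exact: metric_bounded_closed_ball].
have pC n : C (p n) (p n).1 by rewrite /C /= metric_distxx ltW.
pose u (n : nat) : metric_space d := (p n).1.
have [z [C0z clz]] : C (p 0%N) `&` cluster (u @ \oo) !=set0.
  apply: (Cc 0%N); exists 0%N => // n _ /=; exact: (Csub 0%N n).
have Cz n : C (p n) z.
  apply: (@closed_closed_ball d (p n).1 (p n).2 z) => B zB.
  apply: (clz (C (p n))) => //; exists n => // m /= nm.
  exact: (Csub _ _ nm).
have [_ _ /(_ z erefl)] := gP (f z, p (f z)) (p0 _).
by move=> /(_ (Cz (f z).+1)).
Qed.

Lemma proper_left_invariant_bounded_finite d (A : set (metric_space d)) :
  proper_left_invariant d -> metric_bounded A -> finite_set A.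
Proof.
move=> dP bA; have [e e0 dis] := proper_left_invariant_discrete dP.
have cA : compact A.
  apply: (dP.2) => // p clp.
  have [y [Ay]] := clp _ (nbhsx_ballx p _ e0).
  by rewrite ballEmdist /= => /dis ->.
apply: contrapT => Ainf.
pose F : set_system (metric_space d) := [set B | finite_set (A `\` B)].
have FF : ProperFilter F.
  split; first by rewrite /F /= setD0.
  split.
  - by rewrite /F /= setDT; exact: finite_set0.
  - by move=> B C FB FC; rewrite /F /= setDIr finite_setU.
  - by move=> B C BC; apply: sub_finite_set; exact: setDS.
have [|p [_ clp]] := cA F FF; first by rewrite /F /= setDv; exact: finite_set0.
have Fp : F (~` [set p]).
  rewrite /F /= setDE setCK; apply: (@sub_finite_set _ _ [set p]).
    by move=> x [].
  exact: finite_set1.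
have [y [yp]] := clp _ _ Fp (nbhsx_ballx p _ e0).
by rewrite ballEmdist /= => /dis py; apply: yp; rewrite /= py.
Qed.

Lemma proper_left_invariant_le d1 d2 (D : R) :
  proper_left_invariant d1 -> proper_left_invariant d2 ->
  exists D' : R, forall x y, d1 x y <= D -> d2 x y <= D'.
Proof.
move=> d1P [d2l _].
have /finite_seqP[s sE] := proper_left_invariant_bounded_finite d1P
  (@metric_bounded_closed_ball d1 1%g D).
exists (\sum_(y <- s) d2 1%g y) => x y xy.
have : [set` s] (x^-1 * y)%g.
  by rewrite -sE /= -(d1P.1 x) mulg1 mulVKg.
rewrite /= => ins; have -> : d2 x y = d2 1%g (x^-1 * y)%g.
  by rewrite -(d2l x^-1%g) mulVg.
rewrite (big_rem _ ins) /= lerDl.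
by apply: sumr_ge0 => z _; exact: metric_on_ge0.
Qed.

Lemma family_boundedP (X : metricType R) (B : R) (E : set (set X)) :
  family_bounded B E <->
  forall U x y, E U -> U x -> U y -> mdist x y <= B.
Proof.
split=> [h U x y EU Ux Uy|h].
  rewrite -lee_fin; apply: le_trans h.
  apply: (@le_trans _ _ (diam U)).
    by apply: ereal_sup_ubound; exists x => //; exists y.
  by apply: ereal_sup_ubound; exists U.
apply: ge_ereal_sup => _ [U EU <-]; apply: ge_ereal_sup => _ [x Ux [y Uy <-]].
by rewrite lee_fin; exact: (h U).
Qed.

Lemma proper_left_invariant_asdim_le d1 d2 n :
  proper_left_invariant d1 -> proper_left_invariant d2 ->
  @asdim_le R (metric_space d1) n -> @asdim_le R (metric_space d2) n.
Proof.
move=> d1P d2P h D D0.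
have [D1 D1P] := proper_left_invariant_le D d2P d1P.
have [] := h (Num.max D1 1); first by rewrite lt_max ltr01 orbT.
move=> B [E [EP Ecov]].
have [B2 B2P] := proper_left_invariant_le B d1P d2P.
exists B2, E; split => // i; have [Ed /family_boundedP Eb] := EP i; split.
  move=> U V x y EU EV Ux Vy neq; rewrite ltNge; apply/negP => /D1P le1.
  have := Ed _ _ _ _ EU EV Ux Vy neq.
  by rewrite gt_max /mdist /= ltNge le1.
by apply/family_boundedP => U x y EU Ux Uy; apply/B2P/(Eb U).
Qed.

Lemma proper_left_invariant_asdim d1 d2 :
  proper_left_invariant d1 -> proper_left_invariant d2 ->
  asdim (metric_space d1) = asdim (metric_space d2).
Proof.
move=> d1P d2P.
suff h : @asdim_le R (metric_space d1) = @asdim_le R (metric_space d2).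
  by rewrite /asdim h.
by apply/funext => n; apply/propext; split;
  exact: proper_left_invariant_asdim_le.
Qed.

Lemma group_asdimE d :
  proper_left_invariant d -> group_asdim R G = asdim (metric_space d).
Proof.
move=> dP; rewrite /group_asdim; case: xgetP => [_ -> [d' d'P <-]|].
  exact: proper_left_invariant_asdim.
by move=> /(_ (asdim (metric_space d))) []; exists d.
Qed.

End proper_left_invariant_unique.

(* Main.v *)
Require Import Defs.
From mathcomp Require Import all_boot all_order all_algebra.
From mathcomp Require Import all_classical all_reals.
From mathcomp Require Import ereal topology.

(** Fix a proper left-invariant metric [d] on the countable group [G]; its
    bounded sets are finite.  Asymptotic dimension 0 means that at every scale
    [D] the space [(G, d)] splits into uniformly bounded pieces at distance
    more than [D] from each other.

    Given such pieces and a finite [S] lying in the ball of radius [D] about 1,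
    right multiplication by an element of [S] moves every point by at most [D],
    so it cannot leave a piece.  Hence neither can right multiplication by an
    element of [<S>] ([stable_subgroup]), and [<S>] is contained in the piece of
    1, which is bounded, hence finite ([generated_sub_piece]).

    Conversely, the ball of radius [D] about 1 is finite; if it generates a
    finite subgroup [H], then the left cosets of [H] are the required pieces:
    points at distance at most [D] differ by an element of [H], and all cosets
    are isometric to the bounded set [H] ([asdim_le0_cosets]). *)

Set Implicit Arguments.
Unset Strict Implicit.
Unset Printing Implicit Defensive.

Import Order.TTheory GRing.Theory Num.Theory.

Local Open Scope classical_set_scope.

Lemma finite_set_ub (R : realType) (T : choiceType) (A : set T) (f : T -> R) :
  finite_set A -> exists M : R, forall x, A x -> (f x <= M)%R.
Proof.
move=> /finite_seqP[s ->]; exists (\big[Num.max/0%R]_(x <- s) f x) => x /= xs.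
exact: le_bigmax_seq.
Qed.

Lemma asdim_eq0 (R : realType) (X : metricType R) :
  asdim X = 0%N%:E <-> asdim_le X 0.
Proof.
rewrite /asdim; case: pselect => [ex|nex]; last first.
  by split => // X0; case: nex; exists 0%N; exact/asboolP.
case: ex_minnP => n /asboolP Xn nmin; split=> [[n0]|X0]; first by rewrite -n0.
by have := nmin 0%N (asboolT X0); rewrite leqn0 => /eqP ->.
Qed.

Section Subgroups.
Variable G : groupType.
Implicit Types (H S U : set G) (F : set (set G)).
Local Open Scope group_scope.

Lemma subgroupP H :
  subgroup H <-> H 1 /\ (forall x y, H x -> H y -> H (x / y)).
Proof.
split=> [[/set_mem H1 HB]|[H1 HB]].
  by split=> // x y Hx Hy; apply: set_mem; apply: HB; exact: mem_set.
split=> [|x y /set_mem Hx /set_mem Hy]; first exact: mem_set.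
exact/mem_set/HB.
Qed.

Lemma subgroupV H x : subgroup H -> H x -> H x^-1.
Proof. by move=> /subgroupP[H1 HB] Hx; rewrite -div1g; exact: HB. Qed.

Lemma subgroupM H x y : subgroup H -> H x -> H y -> H (x * y).
Proof.
move=> sH Hx Hy; have /subgroupP[_ HB] := sH.
by rewrite -[y]invgK; apply: HB => //; exact: subgroupV.
Qed.

Lemma subgroup_smallest S : subgroup (smallest (@subgroup G) S).
Proof.
apply/subgroupP; split=> [K [/subgroupP[]//]|x y Sx Sy K KS].
have /subgroupP[_ KB] := KS.1.
by apply: KB; [exact: Sx|exact: Sy].
Qed.

(** The equivalence, rather than the implication from left to right, makes the
    set of such [h] closed under inverses. *)
Definition stable F : set G :=
  [set h | forall U, F U -> forall g, U g <-> U (g * h)].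

Lemma stable_subgroup F : subgroup (stable F).
Proof.
apply/subgroupP; split=> [U _ g|x y Fx Fy U FU g]; first by rewrite mulg1.
rewrite (Fx U FU) (Fy U FU (g * (x / y))).
by rewrite -!mulgA mulVg mulg1.
Qed.

Definition left_cosets H : set (set G) :=
  [set [set y | H (x^-1 * y)] | x in [set: G]].

Lemma left_cosets_div H U x y :
  subgroup H -> left_cosets H U -> U x -> U y -> H (x^-1 * y).
Proof.
move=> sH [z _ <-] /= zx zy.
have -> : x^-1 * y = (z^-1 * x)^-1 * (z^-1 * y) by rewrite invgM invgK mulgA mulgK.
by apply: subgroupM => //; exact: subgroupV.
Qed.

Lemma left_cosets_eq H U V x y : subgroup H ->
  left_cosets H U -> left_cosets H V -> U x -> V y -> H (x^-1 * y) -> U = V.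
Proof.
move=> sH [u _ <-] [v _ <-] /= ux vy xy.
have uv : H (u^-1 * v).
  have -> : u^-1 * v = (u^-1 * x) * (x^-1 * y) * (v^-1 * y)^-1.
    by rewrite invgM invgK !mulgA !mulgK.
  by apply: subgroupM (subgroupV _ _) => //; exact: subgroupM.
apply/seteqP; split=> z /= Hz.
  have -> : v^-1 * z = (u^-1 * v)^-1 * (u^-1 * z) by rewrite invgM invgK mulgA mulgK.
  by apply: subgroupM => //; exact: subgroupV.
have -> : u^-1 * z = (u^-1 * v) * (v^-1 * z) by rewrite mulgA mulgK.
exact: subgroupM.
Qed.

End Subgroups.

Section LeftInvariantMetric.
Variables (R : realType) (G : groupType) (d : metric_on R G).
Hypothesis dl : left_invariant d.
Implicit Types (S H U : set G) (D : R).
Local Open Scope group_scope.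

Lemma left_invariant_dist x y : d x y = d 1 (x^-1 * y).
Proof. by rewrite -(dl x 1) mulg1 mulVKg. Qed.

(** A generator moves every point by at most [D], so by disjointness it keeps
    every point inside its piece; hence [S] is contained in the subgroup
    [stable F]. *)
Lemma generated_sub_piece D S (F : set (set (metric_space d))) U :
    family_disjoint D F -> \bigcup_(V in F) V = [set: G] ->
    (forall s, S s -> (d 1%g s <= D)%R) ->
  F U -> U 1 -> smallest (@subgroup G) S `<=` U.
Proof.
move=> Fdisj Fcov SD FU U1.
have close V W x y : F V -> F W -> V x -> W y -> (d x y <= D)%R -> V = W.
  move=> FV FW Vx Wy xy; apply: contrapT => VW.
  by have := Fdisj V W x y FV FW Vx Wy VW; rewrite /mdist /= ltNge xy.
have S_stable : S `<=` stable F.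
  move=> s Ss V FV g.
  have gs : (d g (g * s)%g <= D)%R by rewrite left_invariant_dist mulKg; exact: SD.
  have [W FW Wgs] : (\bigcup_(V in F) V) (g * s) by rewrite Fcov.
  have [W' FW' W'g] : (\bigcup_(V in F) V) g by rewrite Fcov.
  split=> [Vg|Vgs].
    by rewrite (close V W _ _ FV FW Vg Wgs gs).
  by rewrite -(close W' V _ _ FW' FV W'g Vgs gs).
move=> h Sh; rewrite -[h]mul1g.
by have /(_ U FU 1)[/(_ U1)] := Sh _ (conj (stable_subgroup F) S_stable).
Qed.

(** At scale [D] the pieces are the left cosets of one subgroup [H]: the points
    within [D] of [x] lie in [xH] because the ball of radius [D] about 1 lies in
    [H], and by left invariance the finite set of distances from 1 to [H] bounds
    the diameter of every coset. *)
Lemma asdim_le0_cosets :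
    (forall D, exists H : set G, [/\ subgroup H, finite_set H &
      forall x, (d 1%g x <= D)%R -> H x]) ->
  asdim_le (metric_space d) 0.
Proof.
move=> balls D _; have [H [sH finH DH]] := balls D.
have [B HB] := finite_set_ub (d 1) finH.
exists B, (fun=> left_cosets H); split=> [_|].
  split=> [U V x y FU FV Ux Vy UV|]; last first.
    apply/family_boundedP => U x y FU Ux Uy; rewrite /mdist /= left_invariant_dist.
    exact: HB (left_cosets_div sH FU Ux Uy).
  rewrite ltNge; apply/negP => xy; apply: UV.
  apply: (left_cosets_eq sH FU FV Ux Vy); apply: DH.
  by rewrite -left_invariant_dist.
apply/seteqP; split=> // x _; exists ord0 => //.
exists [set y | H (x^-1 * y)]; first by exists x.
by rewrite /= mulVg; have /subgroupP[] := sH.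
Qed.

End LeftInvariantMetric.

Theorem theorem2 (R : realType) (G : groupType) (Gc : countable [set: G]) :
  group_asdim R G = 0%N%:E <->
  (forall H : set G, subgroup H -> finitely_generated H -> finite_set H).
Proof.
have [d dP] := proper_left_invariant_exists R Gc; have [dl _] := dP.
rewrite (group_asdimE Gc dP) asdim_eq0; split=> [d0 _ _ [S finS ->]|fing].
  have [M SM] := finite_set_ub (d 1%g) finS.
  have [|B [F [Fi Fcov]]] := d0 (Num.max M 1%R).
    by rewrite lt_max ltr01 orbT.
  have [Fdisj /family_boundedP Fbnd] := Fi ord0.
  have {}Fcov : \bigcup_(V in F ord0) V = [set: G].
    apply/seteqP; split=> // x _.
    have [i _] : (\bigcup_(i in [set: 'I_1]) \bigcup_(U in F i) U) x.
      by rewrite Fcov.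
    by rewrite (ord1 i).
  have [U FU U1] : (\bigcup_(V in F ord0) V) 1%g by rewrite Fcov.
  apply: (@sub_finite_set _ _ U).
    apply: (generated_sub_piece dl Fdisj Fcov _ FU U1) => s Ss.
    by rewrite le_max SM.
  apply: (proper_left_invariant_bounded_finite Gc dP).
  by exists B => x y; exact: Fbnd.
apply: asdim_le0_cosets => // D.
pose S : set G := [set x | (d 1%g x <= D)%R].
have finS : finite_set S.
  exact: (proper_left_invariant_bounded_finite Gc dP
    (@metric_bounded_closed_ball _ _ d 1%g D)).
exists (smallest (@subgroup G) S); split; first exact: subgroup_smallest.
  by apply: fing; [exact: subgroup_smallest|exists S].
by move=> x Sx; exact: sub_gen_smallest.
Qed.
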